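(* Consider the single-item setting ($m=1$) in which the players' valuations are arbitrary. The Sequential Mechanism is $\alpha$-approximate with respect to social cost for each of the following cost functions: (1) Set Cover cost, with $\alpha=d$, where $d$ is the maximum cardinality of a set in $\mathcal{F}$; (2) Vertex Cover cost in a graph of maximum degree $k$, with $\alpha=k$; (3) Matching cost in a bipartite graph of maximum degree $k$, with $\alpha=k$; (4) Matching cost in a general graph of maximum degree $k$, with $\alpha=(5k+3)/4$.
   Context: Single item: an allocation is a set $T$ of served players with cost $c(T)$; each player $i$ has value $v_i\ge0$; social cost $\pi(T)=c(T)+\sum_{i\notin T}v_i$; $\alpha$-approximate means the output $T$ satisfies $\pi(T)\le\alpha\min_{T'}\pi(T')$ for all truthfully reported values. Sequential Mechanism (single item): process players in a fixed order; with $T$ the set served so far, player $i$ is served (added to $T$) iff her value strictly exceeds the price $c(T\cup\{i\})-c(T)$, which she then pays. Cost functions: (1) Set Cover: universe $U$ and family $\mathcal{F}\subseteq 2^U$ whose union is $U$; players are the elements of $U$; $c(S)$ is the minimum number of sets of $\mathcal{F}$ whose union contains $S$. (2) Vertex Cover: undirected unweighted graph $G=(V,E)$; players are the edges; $c(S)$ is the minimum size of a vertex set covering all edges in $S$. (3),(4) Matching: undirected unweighted graph $G=(V,E)$; players are the edges; $c(S)$ is the maximum cardinality of a matching contained in $S$. *)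

(* Defs.v *)
From HB Require Import structures.
From mathcomp Require Import all_boot all_order all_algebra.
Set Implicit Arguments. Unset Strict Implicit. Unset Printing Implicit Defensive.
Import Order.TTheory GRing.Theory Num.Theory.
Local Open Scope ring_scope.

Section Mech.
Variables (R : realFieldType) (P : finType).

Definition seqmech (c : {set P} -> nat) (v : P -> R) (s : seq P) : {set P} :=
  foldl (fun T i => if (c (i |: T))%:R - (c T)%:R < v i then i |: T else T)
        set0 s.

Definition social_cost (c : {set P} -> nat) (v : P -> R) (N : {set P})
    (T : {set P}) : R :=
  (c T)%:R + \sum_(i in N :\: T) v i.

Definition seqmech_approx (c : {set P} -> nat) (N : {set P}) (alpha : R) :=
  forall (s : seq P) (v : P -> R),
    perm_eq s (enum N) ->
    (forall i, i \in N -> 0 <= v i) ->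
    forall T' : {set P}, T' \subset N ->
      social_cost c v N (seqmech c v s) <= alpha * social_cost c v N T'.
End Mech.

(* c(S) = minimum number of sets of F whose union contains S
   (F itself is always a candidate when F covers the universe). *)
Definition setcover_cost (U : finType) (F : {set {set U}}) (S : {set U}) : nat :=
  \big[minn/#|F|]_(G in powerset F | S \subset cover G) #|G|.

Definition max_set_size (U : finType) (F : {set {set U}}) : nat :=
  \max_(A in F) #|A|.

Definition simple_graph (V : finType) (E : {set {set V}}) : bool :=
  [forall e in E, #|e| == 2].

Definition degree (V : finType) (E : {set {set V}}) (x : V) : nat :=
  #|[set e in E | x \in e]|.

Definition max_degree (V : finType) (E : {set {set V}}) : nat :=
  \max_(x : V) degree E x.

Definition bipartite (V : finType) (E : {set {set V}}) : Prop :=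
  exists X : {set V}, forall e, e \in E -> #|e :&: X| = 1.

Definition vertexcover_cost (V : finType) (S : {set {set V}}) : nat :=
  \big[minn/#|V|]_(C : {set V} | [forall e in S, e :&: C != set0]) #|C|.

Definition is_matching (V : finType) (M : {set {set V}}) : bool :=
  [forall e1 in M, forall e2 in M, (e1 != e2) ==> [disjoint e1 & e2]].

Definition matching_cost (V : finType) (S : {set {set V}}) : nat :=
  \max_(M in powerset S | is_matching M) #|M|.

(* Main.v *)
(* A price is a marginal cost, hence at most 1 here, so the mechanism spends at
   most min(v_i, 1) on each player i.  Against an allocation T', the players
   outside T' account for at most their values and those of T' for at most 1
   each; it is thus enough to show |S| <= alpha * c(S) for every set S of players.

   For coverings this is counting.  For matchings, put a = k (bipartite) or
   a = k + 1 (general); |E| <= a * nu(E) goes by induction on nu.  If some vertex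
   lies in every maximum matching, deleting it removes at most k edges and
   decreases nu by one.  Otherwise, by Gallai's lemma, "no maximum matching misses
   both u and v" is an equivalence relation; edges stay inside its classes and a
   maximum matching misses at most one vertex of each, so a class with m matching
   edges has at most 2m + 1 vertices, hence at most a * m edges.  Finally
   k + 1 <= (5k + 3) / 4 as soon as k >= 1. *)
Require Import Defs.
From mathcomp Require Import all_boot all_order all_algebra.
From mathcomp Require Import zify lra.
Set Implicit Arguments. Unset Strict Implicit. Unset Printing Implicit Defensive.
Import Order.TTheory GRing.Theory Num.Theory.
Local Open Scope ring_scope.

Section SequentialMechanism.
Variables (R : realFieldType) (P : finType).
Implicit Types (c : {set P} -> nat) (v : P -> R) (N S T : {set P}) (s : seq P).

Definition marginals_le1 c N :=
  forall i T, i \in N -> T \subset N -> (c (i |: T) <= (c T).+1)%N.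

Lemma seqmech_rcons c v s i (T := seqmech c v s) :
  seqmech c v (rcons s i) =
  if (c (i |: T))%:R - (c T)%:R < v i then i |: T else T.
Proof. exact: foldl_rcons. Qed.

Lemma seqmech_sub c v s : seqmech c v s \subset [set:: s].
Proof.
elim/last_ind: s => [|s i IHs]; first exact: sub0set.
have sub : seqmech c v s \subset [set:: rcons s i].
  apply: subset_trans IHs _; apply/subsetP => x.
  by rewrite !inE mem_rcons inE orbC => ->.
rewrite seqmech_rcons; case: ifP => // _.
by rewrite subUset sub1set inE mem_rcons mem_head.
Qed.

Lemma eq_seqmech c c' v : c =1 c' -> seqmech c v =1 seqmech c' v.
Proof.
by move=> eqc; elim/last_ind => // s i IHs; rewrite !seqmech_rcons IHs !eqc.
Qed.

Lemma eq_seqmech_approx c c' N (alpha : R) :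
  c =1 c' -> seqmech_approx c N alpha -> seqmech_approx c' N alpha.
Proof.
move=> eqc approx_c s v sN v0 T TN; have := approx_c s v sN v0 T TN.
by rewrite /social_cost !eqc (eq_seqmech v eqc).
Qed.

Lemma social_cost_seqmech_le c v N s :
    c set0 = 0%N -> marginals_le1 c N -> uniq s -> {subset s <= N} ->
  social_cost c v [set:: s] (seqmech c v s) <= \sum_(i <- s) Num.min (v i) 1.
Proof.
move=> c0 c1; elim/last_ind: s => [|s i IHs].
  by rewrite /social_cost big_nil /seqmech /= set_nil set0D big_set0 c0 addr0.
rewrite rcons_uniq => /andP[Nis Us] sN.
have iN : i \in N by apply: sN; rewrite mem_rcons mem_head.
have {}sN : {subset s <= N} by move=> x xs; rewrite sN // mem_rcons inE xs orbT.
have {}IHs := IHs Us sN.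
have Ts := seqmech_sub c v s; have iNT : i \notin seqmech c v s.
  by apply: contra Nis => /(subsetP Ts); rewrite inE.
have TN : seqmech c v s \subset N.
  by apply: subset_trans Ts _; apply/subsetP => x; rewrite inE => /sN.
have := c1 i _ iN TN; rewrite -(ler_nat R) mulrS => c_le.
have -> : [set:: rcons s i] = i |: [set:: s].
  by apply/setP => x; rewrite !inE mem_rcons inE.
move: IHs; rewrite /social_cost seqmech_rcons big_rcons /= => IHs.
case: ifPn => [served|]; last rewrite -leNgt => rejected.
  have -> : (i |: [set:: s]) :\: (i |: seqmech c v s) = [set:: s] :\: seqmech c v s.
    by apply/setP => x; rewrite !inE; case: eqP => // ->; rewrite (negPf Nis) andbF.
  have : (c (i |: seqmech c v s))%:R - (c (seqmech c v s))%:R <= Num.min (v i) 1.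
    by rewrite le_min (ltW served) /=; lra.
  lra.
have -> : (i |: [set:: s]) :\: seqmech c v s = i |: ([set:: s] :\: seqmech c v s).
  by apply/setP => x; rewrite !inE; case: eqP => // ->; rewrite iNT.
rewrite big_setU1 /=; last by rewrite !inE (negPf Nis) andbF.
have : v i <= Num.min (v i) 1 by rewrite le_min lexx /=; lra.
lra.
Qed.

Lemma seqmech_approx_card_le c N (alpha : R) :
    c set0 = 0%N -> marginals_le1 c N ->
    (forall S, S \subset N -> #|S|%:R <= alpha * (c S)%:R) ->
  seqmech_approx c N alpha.
Proof.
move=> c0 c1 card_le s v ps v0 T TN.
have sE : [set:: s] = N by apply/setP => x; rewrite inE (perm_mem ps) mem_enum.
have Us : uniq s by rewrite (perm_uniq ps) enum_uniq.
have sN : {subset s <= N} by move=> x; rewrite -sE inE.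
have := social_cost_seqmech_le v c0 c1 Us sN; rewrite sE => /le_trans; apply.
rewrite (perm_big _ ps) /= big_enum (big_setID T) /= (setIidPr TN) mulrDr.
apply: lerD.
  apply: le_trans (card_le T TN); rewrite -sum1_card natr_sum.
  by apply: ler_sum => i _; rewrite ge_min lexx orbT.
rewrite mulr_sumr; apply: ler_sum => i /setDP[iN _].
suff alpha_ge1 : 1 <= alpha by rewrite ge_min ler_peMl // v0.
have := card_le [set i]; rewrite sub1set cards1 => /(_ iN).
have := c1 i set0 iN (sub0set _); rewrite setU0 c0.
by case: (c [set i]) => [|[|//]] _; rewrite ?mulr0 ?mulr1 // ler10.
Qed.
End SequentialMechanism.

Local Open Scope nat_scope.

Section Coverings.
Variables I P : finType.
Implicit Types (r : I -> {set P}) (C F : {set I}) (N S T : {set P}).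

Lemma double_counting r C S n d :
    {in S, forall p, n <= #|[set i in C | p \in r i]|} ->
    {in C, forall i, #|S :&: r i| <= d} ->
  n * #|S| <= d * #|C|.
Proof.
move=> n_le le_d; rewrite mulnC -sum_nat_const.
apply: leq_trans (leq_sum _ n_le) _.
under eq_bigr do rewrite -sum1_card.
rewrite (exchange_big_dep (mem C)) /= => [|p i _]; last by rewrite inE => /andP[].
rewrite mulnC -sum_nat_const; apply: leq_sum => i iC.
apply: leq_trans (le_d i iC); rewrite sum1_card subset_leq_card //.
by apply/subsetP => p; rewrite unfold_in !inE iC.
Qed.

(* A set that [F] cannot cover gets the junk cost [#|F|]. *)
Definition covering_cost r F S : nat :=
  \big[minn/#|F|]_(C in powerset F | S \subset \bigcup_(i in C) r i) #|C|.

Variables (r : I -> {set P}) (F : {set I}).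

Lemma covering_cost_le C S :
  C \subset F -> S \subset \bigcup_(i in C) r i -> covering_cost r F S <= #|C|.
Proof.
move=> CF SC; rewrite /covering_cost -minEnat.
by apply: (@bigmin_le_cond _ nat _ #|F|); rewrite powersetE CF.
Qed.

Lemma covering_cost_attained S : S \subset \bigcup_(i in F) r i ->
  exists C, [/\ C \subset F, S \subset \bigcup_(i in C) r i
              & covering_cost r F S = #|C|].
Proof.
move=> SF; rewrite /covering_cost -minEnat.
pose covers C := (C \in powerset F) && (S \subset \bigcup_(i in C) r i).
have [||C] := @eq_bigmin _ nat _ #|F| F covers (fun C => #|C|).
- by rewrite /covers powersetE subxx.
- by move=> C; rewrite /covers powersetE => /andP[/subset_leq_card].
- by rewrite unfold_in /covers powersetE => /andP[CF SC] ->; exists C.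
Qed.

Lemma covering_cost0 : covering_cost r F set0 = 0.
Proof.
by apply/eqP; rewrite -leqn0 -(@cards0 I) covering_cost_le ?sub0set.
Qed.

Lemma covering_cost_marginals_le1 N :
  N \subset \bigcup_(i in F) r i -> marginals_le1 (covering_cost r F) N.
Proof.
move=> NF p T pN TN.
have [C [CF TC ->]] := covering_cost_attained (subset_trans TN NF).
have /bigcupP[i iF pi] := subsetP NF p pN.
apply: (@leq_trans #|i |: C|); last by rewrite cardsU1; case: (_ \notin _); lia.
apply: covering_cost_le; first by rewrite subUset sub1set iF.
by rewrite bigcup_setU big_set1 setUSS ?sub1set.
Qed.

Lemma card_le_covering_cost S d :
    S \subset \bigcup_(i in F) r i -> {in F, forall i, #|S :&: r i| <= d} ->
  #|S| <= d * covering_cost r F S.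
Proof.
move=> /covering_cost_attained[C [CF SC ->]] le_d; rewrite -[#|S|]mul1n.
apply: (@double_counting r) => [p pS | i /(subsetP CF)]; last exact: le_d.
have /bigcupP[i iC pi] := subsetP SC p pS.
by apply/card_gt0P; exists i; rewrite inE iC.
Qed.

Lemma covering_seqmech_approx (R : realFieldType) N d :
    N \subset \bigcup_(i in F) r i -> {in F, forall i, #|N :&: r i| <= d} ->
  seqmech_approx (covering_cost r F) N (d%:R : R)%R.
Proof.
move=> NF le_d; apply: seqmech_approx_card_le => [||S SN].
- exact: covering_cost0.
- exact: covering_cost_marginals_le1.
- rewrite -natrM ler_nat card_le_covering_cost ?(subset_trans SN) // => i iF.
  exact: leq_trans (subset_leq_card (setSI _ SN)) (le_d i iF).
Qed.
End Coverings.

Lemma setcover_seqmech_approx (R : realFieldType) (U : finType) (F : {set {set U}}) :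
  cover F = setT ->
  seqmech_approx (setcover_cost F) setT ((max_set_size F)%:R : R)%R.
Proof.
move=> coverF; apply: (@covering_seqmech_approx _ _ id) => [|A AF].
  by rewrite -/(cover F) coverF.
by rewrite setTI; apply: leq_bigmax_cond.
Qed.

Section Graphs.
Variable V : finType.
Implicit Types (E S : {set {set V}}) (C e : {set V}) (x y : V).

Definition star x := [set e : {set V} | x \in e].

Lemma degreeE S x : degree S x = #|S :&: star x|.
Proof. by rewrite /degree setIdE. Qed.

Lemma degree_le_max E x : degree E x <= max_degree E.
Proof. exact: leq_bigmax. Qed.

Lemma degreeS S E x : S \subset E -> degree S x <= degree E x.
Proof. by move=> SE; rewrite !degreeE subset_leq_card // setSI. Qed.

Lemma max_degreeS S E : S \subset E -> max_degree S <= max_degree E.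
Proof.
move=> SE; apply/bigmax_leqP => x _.
exact: leq_trans (degreeS x SE) (degree_le_max E x).
Qed.

Lemma simple_graphS S E : S \subset E -> simple_graph E -> simple_graph S.
Proof. by move=> /subsetP SE /forall_inP sE; apply/forall_inP => e /SE/sE. Qed.

Lemma bipartiteS S E : S \subset E -> bipartite E -> bipartite S.
Proof. by move=> /subsetP SE [X EX]; exists X => e /SE/EX. Qed.

Lemma card_edge E e : simple_graph E -> e \in E -> #|e| = 2.
Proof. by move=> /forall_inP sE /sE/eqP. Qed.

Lemma edge_has_vertex E e : simple_graph E -> e \in E -> exists x, x \in e.
Proof. by move=> sE eE; apply/card_gt0P; rewrite (card_edge sE eE). Qed.

Lemma simple_graph_set0 E : simple_graph E -> set0 \notin E.
Proof. by move=> sE; apply/negP => /(card_edge sE); rewrite cards0. Qed.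

Lemma edgeE E e x y :
  simple_graph E -> e \in E -> x \in e -> y \in e -> x != y -> e = [set x; y].
Proof.
move=> sE eE xe ye xy; apply/esym/eqP.
by rewrite eqEcard (card_edge sE eE) cards2 xy subUset !sub1set xe ye.
Qed.

Lemma max_degree_gt0 E : simple_graph E -> E != set0 -> 0 < max_degree E.
Proof.
move=> sE /set0Pn[e eE]; have [x xe] := edge_has_vertex sE eE.
apply: leq_trans (degree_le_max E x); rewrite degreeE.
by apply/card_gt0P; exists e; rewrite !inE eE.
Qed.

Lemma vertexcover_costE S : vertexcover_cost S = covering_cost star setT S.
Proof.
rewrite /vertexcover_cost /covering_cost cardsT; apply: eq_bigl => C.
rewrite powersetE subsetT /=; apply/forall_inP/subsetP => SC e eS.
  have /set0Pn[x /setIP[xe xC]] := SC e eS.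
  by apply/bigcupP; exists x; rewrite ?inE.
have /bigcupP[x xC] := SC e eS; rewrite inE => xe.
by apply/set0Pn; exists x; rewrite inE xe.
Qed.

Lemma vertexcover_seqmech_approx (R : realFieldType) E :
  simple_graph E ->
  seqmech_approx (@vertexcover_cost V) E ((max_degree E)%:R : R)%R.
Proof.
move=> sE; apply: (eq_seqmech_approx (fsym vertexcover_costE)).
apply: covering_seqmech_approx => [|x _]; last by rewrite -degreeE degree_le_max.
apply/subsetP => e eE; have [x xe] := edge_has_vertex sE eE.
by apply/bigcupP; exists x; rewrite ?inE.
Qed.
End Graphs.

Section Matchings.
Variable V : finType.
Implicit Types (E S M N : {set {set V}}) (C : {set V}) (e f g : {set V}).
Implicit Types (u v w x y : V).

Lemma is_matchingE M : is_matching M = trivIset M.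
Proof.
apply/forall_inP/trivIsetP => [mM e f eM fM | mM e eM].
  by have /forall_inP/(_ f fM)/implyP := mM e eM.
by apply/forall_inP => f fM; apply/implyP; apply: mM.
Qed.

Lemma card_le_matching_cost M S :
  M \subset S -> trivIset M -> #|M| <= matching_cost S.
Proof.
by move=> MS tM; apply: (bigop.bigmax_sup M); rewrite // powersetE MS is_matchingE.
Qed.

Definition maximum_matching E M :=
  [&& M \subset E, trivIset M & #|M| == matching_cost E].

Lemma maximum_matching_exists E : exists M, maximum_matching E M.
Proof.
pose P M := (M \in powerset E) && is_matching M.
have P0 : P set0.
  by rewrite /P powersetE sub0set is_matchingE; apply/trivIsetP => e f; rewrite inE.
rewrite /maximum_matching /matching_cost (bigop.bigmax_eq_arg set0 P0).
case: arg_maxnP => // M /andP[]; rewrite powersetE is_matchingE => ME tM _.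
by exists M; rewrite ME tM eqxx.
Qed.

Lemma matching_cost0 : matching_cost (set0 : {set {set V}}) = 0.
Proof.
have [M /and3P[]] := maximum_matching_exists set0.
by rewrite subset0 => /eqP-> _ /eqP <-; rewrite cards0.
Qed.

Lemma matching_cost_marginals_le1 E : marginals_le1 (@matching_cost V) E.
Proof.
move=> e S _ _; have [M /and3P[MS tM /eqP <-]] := maximum_matching_exists (e |: S).
have : #|M :\ e| <= matching_cost S.
  by rewrite card_le_matching_cost ?subDset // (trivIsetS (subsetDl M _)).
by rewrite (cardsD1 e M); case: (e \in M) => /= ?; lia.
Qed.

Lemma card_cover_matching M : simple_graph M -> trivIset M -> #|cover M| = 2 * #|M|.
Proof.
move=> sM /eqP <-; rewrite mulnC -sum_nat_const.
by apply: eq_bigr => e; apply: card_edge.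
Qed.

Lemma maximum_matching_meets E M e :
    simple_graph E -> maximum_matching E M -> e \in E ->
  exists2 x, x \in e & x \in cover M.
Proof.
move=> sE /and3P[ME tM /eqP cM] eE.
have [/exists_inP//|/exists_inPn eNM] := boolP [exists x in e, x \in cover M].
have M0 := simple_graph_set0 (simple_graphS ME sE).
have dis : {in M, forall f, [disjoint e & f]}.
  move=> f fM; rewrite disjoints_subset; apply/subsetP => x /eNM.
  by rewrite inE; apply: contra => xf; apply/bigcupP; exists f.
have [tM' eM] := trivIsetU1 dis tM M0.
have := card_le_matching_cost (_ : e |: M \subset E) tM'.
by rewrite subUset sub1set eE ME cardsU1 eM cM ltnn => /(_ isT).
Qed.

Lemma maximum_matching_swap E N f x y :
    simple_graph E -> maximum_matching E N -> [set x; y] \in E ->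
    x \notin cover N -> f \in N -> y \in f ->
  maximum_matching E ([set x; y] |: N :\ f).
Proof.
move=> sE /and3P[NE tN /eqP cN] xyE xN fN yf.
have N'N : N :\ f \subset N by apply: subsetDl.
have N0 := simple_graph_set0 (simple_graphS (subset_trans N'N NE) sE).
have dis : {in N :\ f, forall g, [disjoint [set x; y] & g]}.
  move=> g /setD1P[gf gN]; rewrite disjoints_subset subUset !sub1set !inE.
  apply/andP; split; first by apply: contra xN => xg; apply/bigcupP; exists g.
  by apply: contra gf => yg; rewrite -(def_pblock tN gN yg) (def_pblock tN fN yf).
have [tN' xyN] := trivIsetU1 dis (trivIsetS N'N tN) N0.
rewrite /maximum_matching tN' subUset sub1set xyE (subset_trans N'N NE) /=.
by rewrite cardsU1 xyN -cN [in #|N|](cardsD1 f) fN.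
Qed.

Lemma maximum_matching_exchange E M N x :
    simple_graph E -> maximum_matching E M -> maximum_matching E N ->
    x \in cover M :\: cover N ->
  exists N', [/\ maximum_matching E N', cover N' \subset x |: cover N
               & #|M :&: N| < #|M :&: N'|].
Proof.
move=> sE maxM maxN /setDP[/bigcupP[e eM xe] xN].
have [/subsetP ME tM _] := and3P maxM; have eE := ME e eM.
have [y ye yN] := maximum_matching_meets sE maxN eE.
have /bigcupP[f fN yf] := yN.
have xy : x != y by apply: contraNneq xN => ->.
have exy := edgeE sE eE xe ye xy.
have eN : e \notin N by apply: contra xN => eN; apply/bigcupP; exists e.
have fM : f \notin M.
  by apply: contra eN => fM; rewrite -(def_pblock tM eM ye) (def_pblock tM fM yf).
exists (e |: N :\ f); split.
- by rewrite exy; apply: maximum_matching_swap => //; rewrite -exy.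
- apply/bigcupsP => g /setU1P[->|/setD1P[_ gN]].
    by rewrite exy subUset !sub1set !inE eqxx yN orbT.
  by apply: subset_trans (subsetUr _ _); apply: bigcup_sup gN.
- suff /subset_leq_card : e |: (M :&: N) \subset M :&: (e |: N :\ f).
    by rewrite cardsU1 inE (negPf eN) andbF.
  rewrite subUset sub1set inE eM setU11 /=; apply/subsetP => g /setIP[gM gN].
  by rewrite !inE gM gN andbT; apply/orP; right; apply: contraNneq fM => <-.
Qed.

Definition missable E w := [exists M, maximum_matching E M && (w \notin cover M)].

Definition never_both_missed E : rel V := fun u v =>
  [forall M, [&& maximum_matching E M, u \notin cover M & v \notin cover M]
             ==> (u == v)].

Lemma never_both_missedP E u v :
  reflect
    (forall M, maximum_matching E M -> u \notin cover M -> v \notin cover M -> u = v)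
    (never_both_missed E u v).
Proof.
apply: (iffP forallP) => [uv M maxM uM vM | uv M].
  by apply/eqP/(implyP (uv M)); rewrite maxM uM.
by apply/implyP => /and3P[maxM uM vM]; apply/eqP; apply: uv uM vM.
Qed.

Lemma never_both_missed_sym E : symmetric (never_both_missed E).
Proof.
by move=> u v; apply/never_both_missedP/never_both_missedP => uv M *; rewrite (uv M).
Qed.

Lemma edge_never_both_missed E e u v :
  simple_graph E -> e \in E -> u \in e -> v \in e -> never_both_missed E u v.
Proof.
move=> sE eE ue ve; apply/never_both_missedP => M maxM uM vM.
have [//|uv] := eqVneq u v; have [x] := maximum_matching_meets sE maxM eE.
by rewrite (edgeE sE eE ue ve uv) => /set2P[] ->; rewrite ?(negPf uM) ?(negPf vM).
Qed.

(* Gallai's lemma: if [M] misses [u] and [v], then a maximum matching [N] missing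
   [w] and sharing as many edges as possible with [M] covers [u] and [v], so [M]
   covers a vertex other than [w] that [N] misses, and [N] can be improved. *)
Lemma never_both_missed_trans E u v w :
    simple_graph E -> missable E w ->
  never_both_missed E u w -> never_both_missed E w v -> never_both_missed E u v.
Proof.
move=> sE /existsP[N0 maxN0] /never_both_missedP uw /never_both_missedP wv.
apply/never_both_missedP => M maxM uM vM; have [//|uv] := eqVneq u v.
pose missing_w N := maximum_matching E N && (w \notin cover N).
have [N /andP[maxN wN] bestN] :=
  arg_maxnP (fun N => #|M :&: N|) (maxN0 : missing_w N0).
have uN : u \in cover N.
  by apply: contraR uv => uN; rewrite (uw N) // (wv M) // -(uw N).
have vN : v \in cover N.
  by apply: contraR uv => vN; rewrite -(wv N) // (uw M) // (wv N).
have [ME tM /eqP cM] := and3P maxM; have [NE tN /eqP cN] := and3P maxN.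
have cover_eq : #|cover M| = #|cover N|.
  by rewrite !card_cover_matching ?(simple_graphS _ sE) // cM cN.
have two_missed : 1 < #|cover M :\: cover N|.
  have -> : 2 = #|[set u; v]| by rewrite cards2 uv.
  rewrite cardsD cover_eq setIC -cardsD subset_leq_card // subUset !sub1set !inE.
  by rewrite uM vM uN vN.
have /card_gt0P[x /setD1P[xw xMN]] : 0 < #|(cover M :\: cover N) :\ w|.
  by move: two_missed; rewrite (cardsD1 w); case: (w \in _) => // /ltnW.
have [N' [maxN' /subsetP N'N]] := maximum_matching_exchange sE maxM maxN xMN.
have missN' : missing_w N'.
  rewrite /missing_w maxN'; apply: contra wN => /N'N /setU1P[wx|//].
  by rewrite wx eqxx in xw.
by rewrite ltnNge [_ <= _](bestN N').
Qed.

Lemma ssetI_subl S C : S ::&: C \subset S.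
Proof. by rewrite /ssetI setIdE subsetIl. Qed.

Lemma card_sum_blocks (Q : {set {set V}}) S :
    trivIset Q -> set0 \notin S ->
    {in S, forall e, exists2 C, C \in Q & e \subset C} ->
  #|S| = \sum_(C in Q) #|S ::&: C|.
Proof.
move=> tQ S0 SQ; under eq_bigr do rewrite -sum1_card.
rewrite (exchange_big_dep (mem S)) /=; last by move=> C e _; rewrite inE => /andP[].
rewrite -sum1_card; apply: eq_bigr => e eS.
have [C CQ eC] := SQ e eS.
have /set0Pn[x xe] : e != set0 by apply: contraNneq S0 => <-.
rewrite (big_pred1 C) // => D; rewrite inE eS /=.
apply/andP/eqP => [[DQ eD]|-> //].
by rewrite -(def_pblock tQ CQ (subsetP eC x xe)) (def_pblock tQ DQ (subsetP eD x xe)).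
Qed.

Lemma card_le_matching_closed M C :
    simple_graph M -> trivIset M ->
    {in M, forall e, {in e, forall x, x \in C -> e \subset C}} ->
  #|C| <= 2 * #|M ::&: C| + #|C :\: cover M|.
Proof.
move=> sM tM closedC; have MCM := ssetI_subl M C.
rewrite -card_cover_matching ?(simple_graphS MCM) ?(trivIsetS MCM) //.
rewrite -(cardsID (cover M) C) leq_add2r subset_leq_card //.
apply/subsetP => x /setIP[xC /bigcupP[e eM xe]].
by apply/bigcupP; exists e; rewrite // inE eM (closedC e eM x).
Qed.

Definition odd_set_bounded a E :=
  forall C m, #|C| <= (2 * m).+1 -> #|E ::&: C| <= a * m.

Lemma odd_set_boundedS a S E :
  S \subset E -> odd_set_bounded a E -> odd_set_bounded a S.
Proof.
move=> SE bE C m /bE; apply: leq_trans; apply: subset_leq_card.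
by rewrite /ssetI !setIdE setSI.
Qed.

Section AllMissable.
Variable E : {set {set V}}.
Hypotheses (sE : simple_graph E) (missableE : forall w, missable E w).

Let classes := equivalence_partition (never_both_missed E) setT.

Lemma never_both_missed_equiv :
  {in [set: V] & &, equivalence_rel (never_both_missed E)}.
Proof.
move=> u v w _ _ _; split=> [|uv]; first exact/never_both_missedP.
apply/idP/idP; apply: never_both_missed_trans => //.
by rewrite never_both_missed_sym.
Qed.

Lemma classes_trivIset : trivIset classes.
Proof. by have /and3P[] := equivalence_partitionP never_both_missed_equiv. Qed.

Lemma mem_class C x y :
  C \in classes -> x \in C -> (y \in C) = never_both_missed E x y.
Proof.
move=> Ccl xC; rewrite -(def_pblock classes_trivIset Ccl xC).
exact: (pblock_equivalence_partition never_both_missed_equiv).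
Qed.

Lemma edge_sub_class C e x :
  C \in classes -> e \in E -> x \in e -> x \in C -> e \subset C.
Proof.
move=> Ccl eE xe xC; apply/subsetP => y ye.
by rewrite (mem_class y Ccl xC) (edge_never_both_missed sE eE).
Qed.

Lemma card_sum_classes S :
  S \subset E -> #|S| = \sum_(C in classes) #|S ::&: C|.
Proof.
move=> SE; apply: card_sum_blocks; first exact: classes_trivIset.
  exact: simple_graph_set0 (simple_graphS SE sE).
move=> e /(subsetP SE) eE; have [x xe] := edge_has_vertex sE eE.
have [/eqP covT _ _] := and3P (equivalence_partitionP never_both_missed_equiv).
have /bigcupP[C Ccl xC] : x \in cover classes by rewrite covT.
by exists C; rewrite // (edge_sub_class Ccl eE xe).
Qed.

Lemma card_class_le M C :
  maximum_matching E M -> C \in classes -> #|C| <= (2 * #|M ::&: C|).+1.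
Proof.
move=> maxM Ccl; have [ME tM _] := and3P maxM; have sM := simple_graphS ME sE.
have closedC : {in M, forall e, {in e, forall x, x \in C -> e \subset C}}.
  by move=> e /(subsetP ME) eE x xe; apply: edge_sub_class.
apply: leq_trans (card_le_matching_closed sM tM closedC) _.
rewrite -[leqRHS]addn1 leq_add2l.
apply/card_le1_eqP => y x /setDP[yC yM] /setDP[xC xM].
by move: yC; rewrite (mem_class y Ccl xC) => /never_both_missedP/(_ M); apply.
Qed.

Lemma card_le_matching_cost_missable a :
  odd_set_bounded a E -> #|E| <= a * matching_cost E.
Proof.
move=> bE; have [M maxM] := maximum_matching_exists E.
have [ME _ /eqP <-] := and3P maxM.
rewrite (card_sum_classes (subxx E)) (card_sum_classes ME) big_distrr /=.
by apply: leq_sum => C Ccl; apply: bE; apply: card_class_le.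
Qed.
End AllMissable.

Lemma matching_cost_delete E v :
  ~~ missable E v -> matching_cost (E :\: star v) < matching_cost E.
Proof.
have [M /and3P[ME tM /eqP cM]] := maximum_matching_exists (E :\: star v).
have [ME' MNv] := subsetDP ME; rewrite -cM => /existsPn/(_ M).
rewrite /maximum_matching ME' tM ltn_neqAle card_le_matching_cost // andbT /=.
apply: contraNN => ->; apply/bigcupP => -[e eM ve].
by have /(subsetP ME) := eM; rewrite !inE ve.
Qed.

Lemma card_le_matching_cost_odd_set E a :
    simple_graph E -> (forall x, degree E x <= a) -> odd_set_bounded a E ->
  #|E| <= a * matching_cost E.
Proof.
have [n] := ubnP (matching_cost E).
elim: n E => // n IHn E /ltnSE nuE sE degE bE.
have [/forallP missableE|/forallPn[v vE]] := boolP [forall w, missable E w].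
  exact: card_le_matching_cost_missable.
have subE := subsetDl E (star v); have nuEv := matching_cost_delete vE.
rewrite -(cardsID (star v) E) -degreeE.
apply: leq_trans (leq_mul (leqnn a) nuEv); rewrite mulnS leq_add //.
apply: IHn => [||x|].
- exact: leq_trans nuEv nuE.
- exact: simple_graphS sE.
- exact: leq_trans (degreeS x subE) (degE x).
- exact: odd_set_boundedS bE.
Qed.

Lemma mul_card_edges_le E C k n :
    (forall x, degree E x <= k) -> {in E, forall e, n <= #|e :&: C|} ->
  n * #|E| <= k * #|C|.
Proof.
move=> degE n_le; apply: (double_counting (r := @star V)) => [e eE|x _].
  apply: leq_trans (n_le e eE) _; rewrite setIC subset_leq_card //.
  by apply/subsetP => x; rewrite !inE.
by rewrite -degreeE.
Qed.

Lemma odd_set_bounded_general E k :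
  simple_graph E -> (forall x, degree E x <= k) -> odd_set_bounded k.+1 E.
Proof.
move=> sE degE C m Cm.
have degC x := leq_trans (degreeS x (ssetI_subl E C)) (degE x).
have deg_le : 2 * #|E ::&: C| <= k * #|C|.
  apply: mul_card_edges_le degC _ => e /setIdP[eE eC].
  by rewrite (setIidPl eC) (card_edge sE eE).
have bin_le : 2 * #|E ::&: C| <= #|C| * #|C|.-1.
  suff : #|E ::&: C| <= 'C(#|C|, 2).
    rewrite -(leq_pmul2l (ltn0Sn 1)) => /leq_trans; apply.
    by rewrite bin2 mul2n halfK leq_subr.
  rewrite -cards_draws; apply/subset_leq_card/subsetP => e /setIdP[eE eC].
  by rewrite inE eC (card_edge sE eE).
(* As [|C| <= 2m + 1], the second bound gives [|C|(|C| - 1)/2 <= (k + 1)m] when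
   [2m <= k], and the first one gives [k|C|/2 <= (k + 1)m] when [k < 2m]. *)
have [mk|km] := leqP (2 * m) k; nia.
Qed.

Lemma odd_set_bounded_bipartite E k :
    simple_graph E -> bipartite E -> (forall x, degree E x <= k) ->
  odd_set_bounded k E.
Proof.
move=> sE [X EX] degE C m Cm.
have degC x := leq_trans (degreeS x (ssetI_subl E C)) (degE x).
have leX : 1 * #|E ::&: C| <= k * #|C :&: X|.
  apply: mul_card_edges_le degC _ => e /setIdP[eE eC].
  by rewrite setIA (setIidPl eC) EX.
have leNX : 1 * #|E ::&: C| <= k * #|C :\: X|.
  apply: mul_card_edges_le degC _ => e /setIdP[eE eC].
  rewrite setIDA (setIidPl eC).
  by have := cardsID X e; rewrite EX // (card_edge sE eE) add1n => -[->].
have := cardsID X C; have [Xm|mX] := leqP #|C :&: X| m; nia.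
Qed.

Lemma card_le_bipartite_matching_cost E :
  simple_graph E -> bipartite E -> #|E| <= max_degree E * matching_cost E.
Proof.
move=> sE bE; have degE := degree_le_max E.
exact: card_le_matching_cost_odd_set (odd_set_bounded_bipartite sE bE degE).
Qed.

Lemma card_le_general_matching_cost E :
  simple_graph E -> #|E| <= (max_degree E).+1 * matching_cost E.
Proof.
move=> sE; have degE := degree_le_max E.
apply: card_le_matching_cost_odd_set (odd_set_bounded_general sE degE) => // x.
exact: leqW.
Qed.

Lemma matching_seqmech_approx (R : realFieldType) E (alpha : R) :
    (forall S, S \subset E -> #|S|%:R <= alpha * (matching_cost S)%:R)%R ->
  seqmech_approx (@matching_cost V) E alpha.
Proof.
apply: seqmech_approx_card_le matching_cost0 _.
exact: matching_cost_marginals_le1.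
Qed.

Lemma bipartite_matching_seqmech_approx (R : realFieldType) E :
    simple_graph E -> bipartite E ->
  seqmech_approx (@matching_cost V) E ((max_degree E)%:R : R)%R.
Proof.
move=> sE bE; apply: matching_seqmech_approx => S SE; rewrite -natrM ler_nat.
have := card_le_bipartite_matching_cost (simple_graphS SE sE) (bipartiteS SE bE).
by move=> /leq_trans; apply; rewrite leq_mul2r max_degreeS ?orbT.
Qed.

Lemma general_matching_seqmech_approx (R : realFieldType) E :
    simple_graph E ->
  seqmech_approx (@matching_cost V) E ((5 * max_degree E + 3)%:R / 4%:R : R)%R.
Proof.
move=> sE; apply: matching_seqmech_approx => S SE.
have [->|S0] := eqVneq S set0; first by rewrite cards0 matching_cost0 mulr0.
have sS := simple_graphS SE sE.
rewrite mulrAC ler_pdivlMr ?ltr0n // -!natrM ler_nat.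
have := card_le_general_matching_cost sS; have := max_degree_gt0 sS S0.
by have := max_degreeS SE; nia.
Qed.
End Matchings.

Local Open Scope ring_scope.

Theorem mainTheorem15 (R : realFieldType) :
  (* (1) Set Cover, alpha = d = max cardinality of a set in F *)
  (forall (U : finType) (F : {set {set U}}),
      cover F = [set: U] ->
      seqmech_approx (setcover_cost F) [set: U] ((max_set_size F)%:R : R))
  (* (2) Vertex Cover, alpha = k = max degree *)
  /\ (forall (V : finType) (E : {set {set V}}),
      simple_graph E ->
      seqmech_approx (@vertexcover_cost V) E ((max_degree E)%:R : R))
  (* (3) Matching in a bipartite graph, alpha = k *)
  /\ (forall (V : finType) (E : {set {set V}}),
      simple_graph E -> bipartite E ->
      seqmech_approx (@matching_cost V) E ((max_degree E)%:R : R))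
  (* (4) Matching in a general graph, alpha = (5k+3)/4 *)
  /\ (forall (V : finType) (E : {set {set V}}),
      simple_graph E ->
      seqmech_approx (@matching_cost V) E
        (((5 * max_degree E + 3)%N)%:R / 4%:R : R)).
Proof.
split=> [U F|]; first exact: setcover_seqmech_approx.
split=> [V E|]; first exact: vertexcover_seqmech_approx.
split=> V E; first exact: bipartite_matching_seqmech_approx.
exact: general_matching_seqmech_approx.
Qed.
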